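(* Let $r\ge 2$ be a constant and $\lambda\le n^r$. Consider $\lambda$ isolated islands (no migration), each independently running the (1+1) EA with mutation probability $1/n$ on $\mathrm{Fork}_{n,r}$ from an independent uniformly random initial string. Let $T$ be the number of rounds until some island has the optimum. Then $E(T)\in O\!\left(n\log n+\frac{n^{2r}}{\lambda 2^\lambda}+\frac{n^r}{\lambda}\right)$.
   Context: $\mathrm{Fork}_{n,r}(x)=n+1$ if $x=0^r1^{n-r}$, $n+2$ if $x=1^{n-r}0^r$ (the optimum), and $|x|_1$ otherwise, for $n\ge 2r$. The (1+1) EA: each round create $y$ by flipping each bit of the current $x$ independently with probability $1/n$ and set $x\gets y$ if the fitness of $y$ is at least that of $x$. Asymptotics are in $n$, with $\lambda=\lambda(n)$. *)

(* Defs.v *)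
From HB Require Import structures.
From mathcomp Require Import all_boot all_order all_algebra.
From mathcomp Require Import all_classical all_reals all_analysis.
Set Implicit Arguments. Unset Strict Implicit. Unset Printing Implicit Defensive.
Import Order.TTheory GRing.Theory Num.Theory.
Local Open Scope ring_scope.

Definition bits (n : nat) := {ffun 'I_n -> bool}.

Definition ones n (x : bits n) : nat := #|[pred i | x i]|.

Definition trapstr n r : bits n := [ffun i : 'I_n => (r <= i)%N].
Definition optstr n r : bits n := [ffun i : 'I_n => (i < n - r)%N].

Definition fork n r (x : bits n) : nat :=
  if x == trapstr n r then n.+1
  else if x == optstr n r then n.+2
  else ones x.

Definition mut_prob (R : realType) n (x y : bits n) : R :=
  \prod_(i < n) (if x i == y i then 1 - (n%:R)^-1 else (n%:R)^-1).

Definition ea_select n r (x y : bits n) : bits n :=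
  if (fork r x <= fork r y)%N then y else x.

Definition ea_kernel (R : realType) n r (x x' : bits n) : R :=
  \sum_(y : bits n) mut_prob R x y * (ea_select r x y == x')%:R.

Definition islands (lam n : nat) := {ffun 'I_lam -> bits n}.

Definition joint_kernel (R : realType) lam n r (s s' : islands lam n) : R :=
  \prod_(i < lam) ea_kernel R r (s i) (s' i).

Definition joint_init (R : realType) lam n (s : islands lam n) : R :=
  \prod_(i < lam) ((2%:R ^+ n)^-1 : R).

Definition has_opt lam n r (s : islands lam n) : bool :=
  [exists i, s i == optstr n r].

(* surv t s = Pr[ X_t = s and no island had the optimum at rounds 0..t ] *)
Fixpoint surv (R : realType) lam n r (t : nat) (s : islands lam n) : R :=
  match t with
  | 0 => (~~ has_opt r s)%:R * joint_init R s
  | t'.+1 => (~~ has_opt r s)%:R *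
             \sum_(s0 : islands lam n) surv R r t' s0 * joint_kernel R r s0 s
  end.

(* Pr[T > t], T = first round at which some island has the optimum *)
Definition tailT (R : realType) lam n r (t : nat) : R :=
  \sum_(s : islands lam n) surv R (lam := lam) (n := n) r t s.

(* E(T) = sum_{t >= 0} Pr[T > t], as an extended real *)
Definition expT (R : realType) lam n r : \bar R :=
  (\sum_(0 <= t <oo) (tailT R lam n r t)%:E)%E.

(* Main.v *)
Require Import Defs.
From HB Require Import structures.
From mathcomp Require Import all_boot all_order all_algebra.
From mathcomp Require Import all_classical all_reals all_analysis.
From mathcomp Require Import ring lra zify.
Set Implicit Arguments. Unset Strict Implicit. Unset Printing Implicit Defensive.
Import Order.TTheory GRing.Theory Num.Theory.
Local Open Scope ring_scope.

(** The islands are independent, so [Pr(T > t)] is the [lambda]-th power of the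
    probability that a single island has not met the optimum by round [t]. Reversing
    bit strings exchanges trap and optimum and fixes the uniform distribution, so one
    may average this probability over [x] and its reversal; the averaged quantity
    treats trap and optimum alike and is harmonic elsewhere. From the all-ones string
    it equals [h s = k (1 - q)^s + (1 - k) (1 - 2 p)^s] with [p ~ n^-r], [q ~ n^-2r]
    and [k = 1/2 + O(n^-r)]. The number of zeros shrinks by the factor [1 - 1/(e n)]
    per round in expectation, which makes [h s (1 + (1 - 1/(e n))^t * zeros x)] a
    bound for the survival up to round [t + s]. After [t = O(n log n)] rounds the
    correction is at most [n^-r <= 1/lambda], hence only costs a constant when raised
    to the power [lambda], and expanding [(h s)^lambda] binomially and summing over [s]
    gives [n^2r / (lambda 2^lambda)] and [n^r / lambda]. *)

Section RealBounds.
Variable R : realType.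
Implicit Types (x p q k : R) (m l : nat).

Lemma bernoulli_ge x m : 0 <= x -> 1 + m%:R * x <= (1 + x) ^+ m.
Proof.
move=> x0; elim: m => [|m IH]; first by rewrite mul0r addr0 expr0.
rewrite exprS -natr1; have := ler_wpM2l (addr_ge0 ler01 x0) IH.
have := mulr_ge0 (ler0n R m) (mulr_ge0 x0 x0); nra.
Qed.

Lemma subr1_exp_le p m : 0 <= p <= 1 -> (1 - p) ^+ m <= (1 + m%:R * p)^-1.
Proof.
move=> /andP[p0 p1].
have d0 : 0 < 1 + m%:R * p by rewrite ltr_pwDl ?mulr_ge0.
rewrite -[leRHS]mul1r ler_pdivlMr//.
apply: (@le_trans _ _ ((1 - p) ^+ m * (1 + p) ^+ m)).
  by rewrite ler_wpM2l ?bernoulli_ge// exprn_ge0// subr_ge0.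
rewrite -exprMn exprn_ile1//; nra.
Qed.

Lemma geometric_sum_le x (M : nat) : 0 <= x < 1 -> \sum_(s < M) x ^+ s <= (1 - x)^-1.
Proof.
move=> /andP[x0 x1]; have d0 : 0 < 1 - x by rewrite subr_gt0.
rewrite -[leRHS]mul1r ler_pdivlMr// mulrC -opprB mulNr -subrX1 opprB.
by rewrite lerBlDr lerDl exprn_ge0.
Qed.

Lemma geometric_sum_pow_le p m x (M : nat) : 0 < p <= 1 -> (0 < m)%N ->
  0 <= x <= (1 - p) ^+ m -> \sum_(s < M) x ^+ s <= 1 + (m%:R * p)^-1.
Proof.
move=> /andP[p0 p1] m0 /andP[x0 xp].
have mp0 : 0 < m%:R * p by rewrite mulr_gt0 ?ltr0n.
have xle : x <= (1 + m%:R * p)^-1.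
  by apply: le_trans xp _; rewrite subr1_exp_le// (ltW p0).
have e : 1 - (1 + m%:R * p)^-1 = (1 + (m%:R * p)^-1)^-1.
  by field; rewrite !gt_eqF// ?addr_gt0 ?ltr0n.
have e0 : 0 < (1 + (m%:R * p)^-1)^-1 by rewrite invr_gt0 addr_gt0// invr_gt0.
apply: le_trans (geometric_sum_le _ _) _; first by rewrite x0/=; lra.
rewrite -[leRHS]invrK lef_pV2 ?posrE//; lra.
Qed.

Lemma binomial_weight_div k l : 0 < k <= 1 ->
  \sum_(j < l.+1) ((1 - k) ^+ (l - j) * k ^+ j *+ 'C(l, j)) / j.+1%:R
    <= (l.+1%:R * k)^-1.
Proof.
move=> /andP[k0 k1].
have -> : \sum_(j < l.+1) ((1 - k) ^+ (l - j) * k ^+ j *+ 'C(l, j)) / j.+1%:R =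
  (l.+1%:R * k)^-1 * \sum_(j < l.+1) (1 - k) ^+ (l.+1 - j.+1) * k ^+ j.+1 *+ 'C(l.+1, j.+1).
  rewrite mulr_sumr; apply: eq_bigr => j _; rewrite subSS.
  have /(congr1 (fun z => z%:R : R)) := mul_bin_diag l.+1 j; rewrite !natrM/= => e.
  rewrite -2![_ *+ 'C(_, _)]mulr_natr exprS.
  have -> : 'C(l, j)%:R = (l.+1%:R)^-1 * (j.+1%:R * 'C(l.+1, j.+1)%:R) :> R.
    by rewrite -e mulKf// pnatr_eq0.
  by field; rewrite (gt_eqF k0) ![1 + _]addrC !natr1 !pnatr_eq0.
rewrite ler_piMr ?invr_ge0 ?mulr_ge0 ?(ltW k0)//.
have e : ((1 - k) + k) ^+ l.+1 = 1 by rewrite subrK expr1n.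
rewrite -[leRHS]e exprDn [leRHS]big_ord_recl /=.
by rewrite lerDr bin0 mulr_ge0// exprn_ge0 // subr_ge0.
Qed.

(* Expanding the [l]-th power binomially, the [j]-th summand is the contribution of
   the event that exactly [j] of the [l] independent copies escape at the fast rate
   [2 p]; it sums over time to about [1 / (j p)]. *)
Lemma sum_mixture_pow_le k p q l (M : nat) : 0 <= k < 1 -> 0 < q <= 1 ->
  0 < p -> 2 * p <= 1 -> (0 < l)%N ->
  \sum_(s < M) (k * (1 - q) ^+ s + (1 - k) * (1 - 2 * p) ^+ s) ^+ l <=
  1 + k ^+ l / (l%:R * q) + (l.+1%:R * (1 - k))^-1 / p.
Proof.
move=> /andP[k0 k1] /andP[q0 q1] p0 p1 l0.
pose b := 1 - q; pose a := 1 - 2 * p.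
have b0 : 0 <= b by rewrite /b; lra.
have a0 : 0 <= a by rewrite /a; lra.
pose W (j : nat) : R := k ^+ (l - j) * (1 - k) ^+ j *+ 'C(l, j).
have W0 j : 0 <= W j by rewrite mulrn_wge0// mulr_ge0// exprn_ge0//; lra.
have sW : \sum_(j < l.+1) W j = 1.
  by rewrite -exprDn [k + _]addrC subrK expr1n.
have -> : \sum_(s < M) (k * b ^+ s + (1 - k) * a ^+ s) ^+ l =
    \sum_(j < l.+1) W j * \sum_(s < M) (b ^+ (l - j) * a ^+ j) ^+ s.
  rewrite (eq_bigr (fun s : 'I_M => \sum_(j < l.+1) W j * (b ^+ (l - j) * a ^+ j) ^+ s)).
    by rewrite exchange_big; apply: eq_bigr => j _; rewrite mulr_sumr.
  move=> s _; rewrite exprDn; apply: eq_bigr => j _.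
  rewrite /W mulrnAl; congr (_ *+ _).
  by rewrite !exprMn -!exprM ![(s * _)%N]mulnC; ring.
apply: (@le_trans _ _ (\sum_(j < l.+1) (W j +
   ((j == ord0)%:R * (W j / (l%:R * q)) + p^-1 * (W j / j.+1%:R))))).
  apply: ler_sum => j _; rewrite mulrC.
  have [->|j0] := eqVneq j ord0.
    rewrite /= subn0 expr0 mulr1 mul1r.
    apply: (@le_trans _ _ ((1 + (l%:R * q)^-1) * W 0)).
      by rewrite ler_wpM2r// geometric_sum_pow_le ?q0// lexx exprn_ge0.
    rewrite mulrDl mul1r lerD2l mulrC lerDl mulr_ge0 ?invr_ge0 ?(ltW p0)//.
    by rewrite mulr_ge0.
  have jpos : (0 < j)%N by rewrite lt0n.
  rewrite mul0r add0r.
  apply: (@le_trans _ _ ((1 + (j%:R * (2 * p))^-1) * W j)).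
    rewrite ler_wpM2r// geometric_sum_pow_le//; first by rewrite mulr_gt0.
    rewrite mulr_ge0 ?exprn_ge0//= ler_piMl ?exprn_ge0// exprn_ile1// /b; lra.
  rewrite mulrDl mul1r lerD2l [leRHS]mulrCA [leLHS]mulrC ler_wpM2l// -invfM.
  have jR : 1 <= j%:R :> R by rewrite ler1n.
  rewrite lef_pV2 ?posrE ?mulr_gt0 ?ltr0n// -natr1; nra.
rewrite big_split/= sW -addrA lerD2l big_split/= lerD//.
  rewrite big_ord_recl big1 => [|j _]; last by rewrite mul0r.
  by rewrite eqxx mul1r addr0 /W subn0 expr0 mulr1 bin0.
rewrite -mulr_sumr mulrC ler_pM2r ?invr_gt0//.
apply: le_trans (@binomial_weight_div (1 - k) l _); last by rewrite subr_gt0; lra.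
by apply: ler_sum => j _; rewrite subKr.
Qed.

Lemma expR_N1_le_subV m l : (m < l)%N -> expR (-1) <= (1 - l%:R^-1) ^+ m :> R.
Proof.
case: l => // l; rewrite ltnS => ml.
have l1 : 0 < l.+1%:R :> R by rewrite ltr0n.
have [->|] := posnP m; first by rewrite expr0 -[leRHS]expR0 ler_expR lerN10.
move=> m0; have l0 : 0 < l%:R :> R by rewrite ltr0n (leq_trans m0).
have -> : 1 - l.+1%:R^-1 = (1 + l%:R^-1)^-1 :> R.
  by rewrite -natr1; field; rewrite natr1 !gt_eqF.
rewrite expRN exprVn lef_pV2 ?posrE ?expR_gt0 ?exprn_gt0 ?addr_gt0 ?invr_gt0//.
apply: (@le_trans _ _ (expR l%:R^-1 ^+ m)).
  by rewrite lerXn2r ?nnegrE ?expR_ge0 ?expR_ge1Dx// addr_ge0// invr_ge0 ltW.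
by rewrite -expRM_natl ler_expR ler_pdivrMr// mul1r ler_nat.
Qed.

Lemma exp1D_le_expR x m : 0 <= x -> (1 + x) ^+ m <= expR (m%:R * x).
Proof.
by move=> x0; rewrite expRM_natl lerXn2r ?nnegrE ?expR_ge0 ?expR_ge1Dx// addr_ge0.
Qed.
End RealBounds.

Section Mutation.
Variables (R : realType) (n : nat).
Implicit Types x y : bits n.

Definition hamming x y : nat := #|[pred i | x i != y i]|.

Lemma mut_probE x y :
  mut_prob R x y = n%:R^-1 ^+ hamming x y * (1 - n%:R^-1) ^+ (n - hamming x y).
Proof.
rewrite /mut_prob (bigID (fun i => x i != y i))/=; congr (_ * _).
  rewrite /hamming -prodr_const; apply: eq_big => [i|i]; first by rewrite inE.
  by move/negbTE->.
have -> : (n - hamming x y)%N = #|[predC [pred i | x i != y i]]|.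
  by rewrite -[X in (X - _)%N]card_ord -(cardC [pred i | x i != y i]) addKn.
rewrite -prodr_const; apply: eq_big => [i|i]; first by rewrite !inE.
by move/negPn->.
Qed.

Lemma invn_itv : 0 <= (n%:R^-1 : R) <= 1.
Proof.
rewrite invr_ge0 ler0n/=; case: n => [|m]; first by rewrite invr0 ler01.
by rewrite invf_le1 ?ltr0n// ler1n.
Qed.

Lemma mut_prob_ge0 x y : 0 <= mut_prob R x y.
Proof.
have /andP[i0 i1] := invn_itv.
by apply: prodr_ge0 => i _; case: ifP => // _; rewrite subr_ge0.
Qed.

Lemma sum_mut_prob x : \sum_y mut_prob R x y = 1.
Proof.
rewrite -(bigA_distr_bigA (fun i b => if x i == b then 1 - n%:R^-1 else n%:R^-1)).
rewrite big1// => i _; rewrite big_bool; case: (x i) => /=.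
  by rewrite subrK.
by rewrite addrC subrK.
Qed.

Definition rev_bits x : bits n := [ffun i => x (rev_ord i)].

Lemma rev_bitsK : involutive rev_bits.
Proof. by move=> x; apply/ffunP => i; rewrite !ffunE rev_ordK. Qed.

Lemma mut_prob_rev x y : mut_prob R (rev_bits x) (rev_bits y) = mut_prob R x y.
Proof.
rewrite /mut_prob [RHS](reindex_inj rev_ord_inj).
by apply: eq_bigr => i _; rewrite !ffunE.
Qed.

Lemma ones_rev x : ones (rev_bits x) = ones x.
Proof.
rewrite /ones -!sum1_card [RHS](reindex_inj rev_ord_inj).
by apply: eq_bigl => i; rewrite !inE !ffunE.
Qed.

Lemma rev_trapstr r : rev_bits (trapstr n r) = optstr n r.
Proof. by apply/ffunP => i; rewrite !ffunE /=; have := ltn_ord i; lia. Qed.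

Lemma rev_optstr r : rev_bits (optstr n r) = trapstr n r.
Proof. by rewrite -rev_trapstr rev_bitsK. Qed.

Lemma ones_le x : (ones x <= n)%N.
Proof. by rewrite -[leqRHS]card_ord max_card. Qed.

Definition allones : bits n := [ffun=> true].

Lemma ones_allones : ones allones = n.
Proof.
by rewrite /ones -[RHS]card_ord; apply: eq_card => i; rewrite !inE ffunE.
Qed.

Lemma ones_eqn x : ones x = n -> x = allones.
Proof.
rewrite /ones -[RHS]card_ord => e; apply/ffunP => i; rewrite ffunE.
have /subset_leqif_card/geq_leqif := subset_predT [pred i | x i].
by rewrite e leqnn => /esym/fintype.subsetP/(_ i isT).
Qed.

Lemma card_zeros x : #|[pred i | ~~ x i]| = (n - ones x)%N.
Proof.
rewrite -[X in (X - _)%N]card_ord -(cardC [pred i | x i]) addKn.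
by apply: eq_card => i; rewrite !inE.
Qed.

Definition flip (i : 'I_n) x : bits n := [ffun j => if j == i then ~~ x j else x j].

Lemma flip_inj x : injective (flip^~ x).
Proof.
move=> i j /ffunP/(_ i); rewrite !ffunE eqxx; case: eqP => // _.
by case: (x i).
Qed.

Lemma ones_flip i x : ~~ x i -> ones (flip i x) = (ones x).+1.
Proof.
move=> xi; rewrite /ones (cardD1 i) !inE ffunE eqxx xi add1n; congr _.+1.
apply: eq_card => j; rewrite !inE ffunE; case: eqP => [->|]//=.
by rewrite (negbTE xi).
Qed.

Lemma hamming_flip i x : hamming x (flip i x) = 1%N.
Proof.
rewrite /hamming -[RHS](card1 i); apply: eq_card => j; rewrite !inE ffunE.
by case: (eqVneq j i) => [->|_]; [case: (x i)|rewrite eqxx].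
Qed.

End Mutation.

Arguments allones {n}.

Lemma card_ord_lt n m : (m <= n)%N -> #|[pred i : 'I_n | (i < m)%N]| = m.
Proof.
move=> mn; rewrite -sum1_card -[RHS]card_ord -sum1_card.
by rewrite (big_ord_widen _ (fun=> 1%N) mn).
Qed.

Lemma hamming_allones_trap n r : (r <= n)%N -> hamming allones (trapstr n r) = r.
Proof.
move=> rn; rewrite -[RHS](card_ord_lt rn).
by apply: eq_card => i; rewrite !inE !ffunE -ltnNge; case: (_ <= _)%N.
Qed.

Lemma hamming_rev n (x y : bits n) : hamming (rev_bits x) (rev_bits y) = hamming x y.
Proof.
rewrite /hamming -!sum1_card [RHS](reindex_inj rev_ord_inj).
by apply: eq_bigl => i; rewrite !inE !ffunE.
Qed.

Lemma rev_allones n : rev_bits (@allones n) = allones.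
Proof. by apply/ffunP => i; rewrite !ffunE. Qed.

Lemma hamming_allones_opt n r : (r <= n)%N -> hamming allones (optstr n r) = r.
Proof.
by move=> rn; rewrite -rev_allones -rev_trapstr hamming_rev hamming_allones_trap.
Qed.

Lemma hamming_trap_opt n r : (2 * r <= n)%N -> hamming (trapstr n r) (optstr n r) = (2 * r)%N.
Proof.
move=> rn; have rn' : (r <= n)%N by lia.
have -> : (2 * r = hamming allones (trapstr n r) + hamming allones (optstr n r))%N.
  by rewrite hamming_allones_trap// hamming_allones_opt// mul2n addnn.
rewrite /hamming -cardUI -[LHS]addn0; congr (_ + _)%N.
  apply: eq_card => i; rewrite !inE !ffunE.
  by case: (leqP r i) => ?; case: (ltnP i (n - r)) => //= ?; lia.
apply/esym/eq_card0 => i; rewrite !inE !ffunE.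
by case: (leqP r i) => ?; case: (ltnP i (n - r)) => //= ?; lia.
Qed.

Section Fork.
Variables (n r : nat).
Implicit Types x y : bits n.
Local Notation B := (trapstr n r).
Local Notation O := (optstr n r).

Definition special x := (x == B) || (x == O).

Lemma fork_select x y : fork r (ea_select r x y) = maxn (fork r x) (fork r y).
Proof. by rewrite /ea_select maxnE; case: ifP; lia. Qed.

Hypotheses (r0 : (0 < r)%N) (rn : (2 * r <= n)%N).

Lemma trap_neq_opt : B != O.
Proof.
have n0 : (0 < n)%N by lia.
by apply/eqP => /ffunP/(_ (Ordinal n0)); rewrite !ffunE /=; lia.
Qed.

Lemma fork_trap : fork r B = n.+1. Proof. by rewrite /fork eqxx. Qed.

Lemma fork_opt : fork r O = n.+2.
Proof. by rewrite /fork eq_sym (negbTE trap_neq_opt) eqxx. Qed.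

Lemma fork_ones x : ~~ special x -> fork r x = ones x.
Proof. by rewrite negb_or /fork => /andP[/negbTE-> /negbTE->]. Qed.

Lemma fork_special x : special x -> (n < fork r x)%N.
Proof. by case/orP => /eqP->; rewrite ?fork_trap ?fork_opt. Qed.

Lemma fork_ge_ones x : (ones x <= fork r x)%N.
Proof.
have := ones_le x; have [/fork_special|/fork_ones->//] := boolP (special x); lia.
Qed.

Lemma special_rev x : special (rev_bits x) = special x.
Proof.
by rewrite /special !(inv_eq (@rev_bitsK n)) rev_trapstr rev_optstr orbC.
Qed.

Lemma allones_special : special allones = false.
Proof.
have n0 : (0 < n)%N by lia.
have n1 : (n.-1 < n)%N by lia.
apply/negbTE/norP; split; apply/eqP => /ffunP.
  by move/(_ (Ordinal n0)); rewrite !ffunE /=; lia.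
by move/(_ (Ordinal n1)); rewrite !ffunE /=; lia.
Qed.

Lemma ea_select_rev x y : ~~ special x ->
  ea_select r (rev_bits x) (rev_bits y) = rev_bits (ea_select r x y).
Proof.
move=> sx; rewrite /ea_select (fork_ones sx) fork_ones ?special_rev// ones_rev.
have -> : (ones x <= fork r (rev_bits y))%N = (ones x <= fork r y)%N.
  have [sy|sy] := boolP (special y).
    have := fork_special sy.
    by have := @fork_special (rev_bits y); rewrite special_rev => /(_ sy); have := ones_le x; lia.
  by rewrite !fork_ones ?special_rev// ones_rev.
by case: ifP.
Qed.

Lemma ea_select_allones y : ~~ special y -> ea_select r allones y = allones.
Proof.
move=> sy; rewrite /ea_select !fork_ones ?allones_special// ones_allones.
case: ifP => // ny; apply: ones_eqn; have := ones_le y; lia.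
Qed.

Lemma ea_select_trap y : y != O -> ea_select r B y = B.
Proof.
move=> yO; rewrite /ea_select fork_trap; case: ifP => //.
have [->//|yB] := eqVneq y B.
by rewrite fork_ones ?/special ?negb_or ?yB//; have := ones_le y; lia.
Qed.

(* truncated subtraction: [dist] vanishes at the trap and at the optimum *)
Definition dist x : nat := n - fork r x.

Lemma dist_le x : (dist x <= n)%N. Proof. exact: leq_subr. Qed.

Lemma dist_special x : special x -> dist x = 0%N.
Proof. by move/fork_special; rewrite /dist; lia. Qed.

Lemma dist_eq0 x : ~~ special x -> dist x = 0%N -> x = allones.
Proof.
move=> sx; rewrite /dist fork_ones// => d; apply: ones_eqn.
by have := ones_le x; lia.
Qed.

End Fork.

Section Island.
Variables (R : realType) (n r : nat).
Implicit Types (x y : bits n) (f g : bits n -> R) (s t : nat).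
Local Notation B := (trapstr n r).
Local Notation O := (optstr n r).

Definition estep f x : R := \sum_y mut_prob R x y * f (ea_select r x y).

Lemma sum_ea_kernel f x : \sum_y ea_kernel R r x y * f y = estep f x.
Proof.
rewrite /estep /ea_kernel; under eq_bigr do rewrite mulr_suml.
rewrite exchange_big; apply: eq_bigr => z _ /=.
rewrite (bigD1 (ea_select r x z))//= eqxx mulr1 big1 ?addr0// => y /negbTE.
by rewrite eq_sym => ->; rewrite mulr0 mul0r.
Qed.

Lemma estep_le f g x : (forall y, f (ea_select r x y) <= g (ea_select r x y)) ->
  estep f x <= estep g x.
Proof. by move=> fg; apply: ler_sum => y _; rewrite ler_wpM2l ?mut_prob_ge0. Qed.

Lemma estep_affine (c d : R) f x : estep (fun y => c + d * f y) x = c + d * estep f x.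
Proof.
rewrite /estep mulr_sumr -[c in RHS]mulr1 -[X in c * X](sum_mut_prob R x) mulr_sumr.
by rewrite -big_split; apply: eq_bigr => y _ /=; ring.
Qed.

Definition ea_fail t x : R := iter t (fun f x => (x != O)%:R * estep f x) (fun x => (x != O)%:R) x.
Arguments ea_fail : simpl never.

Lemma ea_failS t x : ea_fail t.+1 x = (x != O)%:R * estep (ea_fail t) x.
Proof. by []. Qed.

Lemma ea_fail_itv t x : 0 <= ea_fail t x <= 1.
Proof.
elim: t x => [|t IH] x; first by rewrite /ea_fail /=; case: eqP; rewrite ?lexx ler01.
rewrite ea_failS; case: eqP => _; first by rewrite mul0r lexx ler01.
rewrite mul1r; apply/andP; split.
  by apply: sumr_ge0 => y _; rewrite mulr_ge0 ?mut_prob_ge0//; case/andP: (IH (ea_select r x y)).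
rewrite -[leRHS](sum_mut_prob R x); apply: ler_sum => y _.
by rewrite ler_piMr ?mut_prob_ge0//; case/andP: (IH (ea_select r x y)).
Qed.

Lemma ea_fail_opt t : ea_fail t O = 0.
Proof. by case: t => [|t]; rewrite /ea_fail /= eqxx ?mul0r. Qed.

Definition surv1 t x : R := iteri t
  (fun _ g x => (x != O)%:R * \sum_y g y * ea_kernel R r y x)
  (fun x => (x != O)%:R * (2%:R ^+ n)^-1) x.
Arguments surv1 : simpl never.

Lemma surv1S t x : surv1 t.+1 x = (x != O)%:R * \sum_y surv1 t y * ea_kernel R r y x.
Proof. by []. Qed.

Lemma natr_not_has_opt lam (s : islands lam n) :
  (~~ has_opt r s)%:R = \prod_i (s i != O)%:R :> R.
Proof.
have [/existsP[i si]|/existsPn h] := boolP (has_opt r s).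
  by rewrite (bigD1 i)//= si mul0r.
by rewrite big1// => i _; rewrite h.
Qed.

Lemma surv_prod lam t (s : islands lam n) : surv R r t s = \prod_i surv1 t (s i).
Proof.
elim: t s => [|t IH] s; first by rewrite /= natr_not_has_opt -big_split.
rewrite /= natr_not_has_opt big_split/=; congr (_ * _).
rewrite (bigA_distr_bigA (fun i y => surv1 t y * ea_kernel R r y (s i))).
by apply: eq_bigr => s0 _; rewrite IH -big_split.
Qed.

Lemma surv1_ea_fail t s :
  \sum_x surv1 t x * ea_fail s x = (2%:R ^+ n)^-1 * \sum_x ea_fail (t + s) x.
Proof.
elim: t s => [|t IH] s.
  rewrite mulr_sumr; apply: eq_bigr => x _; rewrite /surv1 /=.
  by case: eqP => [->|]; rewrite ?ea_fail_opt ?mulr0// mul1r.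
rewrite addSnnS -IH; transitivity (\sum_x \sum_y surv1 t y * (ea_kernel R r y x * ea_fail s x)).
  apply: eq_bigr => x _; rewrite surv1S.
  case: eqP => [->|]; first by rewrite ea_fail_opt mulr0 big1// => y _; rewrite !mulr0.
  by rewrite mul1r mulr_suml => _; apply: eq_bigr => y _; rewrite mulrA.
rewrite exchange_big; apply: eq_bigr => y _ /=.
rewrite -mulr_sumr ea_failS sum_ea_kernel.
case: (eqVneq y O) => [->|_]; rewrite ?mul1r// mul0r mulr0.
by case: t {IH} => [|t]; rewrite /surv1 /= eqxx !mul0r.
Qed.

Definition fail_prob t : R := (2%:R ^+ n)^-1 * \sum_x ea_fail t x.

Lemma tailT_fail_prob lam t : tailT R lam n r t = fail_prob t ^+ lam.
Proof.
rewrite /tailT; under eq_bigr do rewrite surv_prod.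
rewrite -(bigA_distr_bigA (fun _ : 'I_lam => surv1 t)) prodr_const card_ord.
congr (_ ^+ _); rewrite -[t in RHS]addn0 /fail_prob -surv1_ea_fail.
apply: eq_bigr => x _; rewrite /ea_fail /=.
case: eqP => [->|]; rewrite ?mulr1// mulr0.
by case: t => [|t]; rewrite /surv1 /= eqxx mul0r.
Qed.

Lemma card_bits : #|bits n| = (2 ^ n)%N.
Proof. by rewrite card_ffun card_bool card_ord. Qed.

Lemma average_le f (c : R) : (forall x, f x <= c) -> (2%:R ^+ n)^-1 * \sum_x f x <= c.
Proof.
move=> fc; rewrite mulrC ler_pdivrMr ?exprn_gt0 ?ltr0n//.
apply: le_trans (ler_sum _ (fun x _ => fc x)) _.
by rewrite sumr_const card_bits -natrX mulr_natr.
Qed.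

Lemma fail_prob_itv t : 0 <= fail_prob t <= 1.
Proof.
rewrite average_le => [|x]; last by case/andP: (ea_fail_itv t x).
rewrite andbT mulr_ge0 ?invr_ge0 ?exprn_ge0// sumr_ge0// => x _.
by case/andP: (ea_fail_itv t x).
Qed.

(* Reversal swaps the trap and the optimum, so from the reversal-invariant initial
   distribution an island is equally likely to meet either of them first. *)
Definition sym_fail t x : R := (ea_fail t x + ea_fail t (rev_bits x)) / 2%:R.

Lemma fail_prob_sym t : fail_prob t = (2%:R ^+ n)^-1 * \sum_x sym_fail t x.
Proof.
rewrite /fail_prob /sym_fail -mulr_suml big_split/=; congr (_ * _).
have -> : \sum_x ea_fail t (rev_bits x) = \sum_x ea_fail t x.
  by rewrite [RHS](reindex_inj (inv_inj (@rev_bitsK n))).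
by field.
Qed.

Hypotheses (r0 : (0 < r)%N) (rn : (2 * r <= n)%N).

Lemma sym_failS t x : ~~ special r x -> sym_fail t.+1 x = estep (sym_fail t) x.
Proof.
move=> sx; have sx' : ~~ special r (rev_bits x) by rewrite special_rev.
rewrite /sym_fail !ea_failS.
move: (sx) (sx'); rewrite !negb_or => /andP[_ ->] /andP[_ ->]; rewrite !mul1r.
have -> : estep (ea_fail t) (rev_bits x) = estep (ea_fail t \o @rev_bits n) x.
  rewrite /estep (reindex_inj (inv_inj (@rev_bitsK n))); apply: eq_bigr => y _ /=.
  by rewrite mut_prob_rev ea_select_rev.
by rewrite /estep -big_split mulr_suml; apply: eq_bigr => y _ /=; ring.
Qed.

Definition pjump : R := n%:R^-1 ^+ r * (1 - n%:R^-1) ^+ (n - r).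
Definition ptrap : R := n%:R^-1 ^+ (2 * r) * (1 - n%:R^-1) ^+ (n - 2 * r).
Definition pstep : R := n%:R^-1 * (1 - n%:R^-1) ^+ (n - 1).

Lemma ea_fail_trap t : ea_fail t B = (1 - ptrap) ^+ t.
Proof.
elim: t => [|t IH]; first by rewrite /ea_fail /= (trap_neq_opt r0 rn).
rewrite ea_failS (trap_neq_opt r0 rn) mul1r exprS -IH /estep (bigD1 O)//=.
have -> : ea_select r B O = O by rewrite /ea_select fork_trap fork_opt// leqnSn.
rewrite ea_fail_opt mulr0 add0r.
rewrite (eq_bigr (fun y => mut_prob R B y * ea_fail t B)) => [|y yO]; last first.
  by rewrite ea_select_trap.
rewrite -mulr_suml; congr (_ * _).
have := sum_mut_prob R B; rewrite (bigD1 O)//= => <-.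
by rewrite mut_probE hamming_trap_opt// addrC addrK.
Qed.

Lemma sym_fail_special t x : special r x -> sym_fail t x = (1 - ptrap) ^+ t / 2%:R.
Proof.
by case/orP => /eqP->; rewrite /sym_fail ?rev_trapstr ?rev_optstr ea_fail_opt
  ea_fail_trap ?addr0 ?add0r.
Qed.

Lemma sym_fail_allones t : sym_fail t.+1 allones =
  (1 - 2%:R * pjump) * sym_fail t allones + pjump * (1 - ptrap) ^+ t.
Proof.
have rn' : (r <= n)%N by lia.
have nsA : ~~ special r (@allones n) by rewrite allones_special.
rewrite sym_failS// /estep (bigD1 B)//= (bigD1 O) ?(eq_sym O) ?trap_neq_opt//=.
have sel y : special r y -> ea_select r allones y = y.
  move=> sy; rewrite /ea_select fork_ones// ones_allones ltnW//.
  exact: (@fork_special _ _ r0 rn).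
rewrite !sel /special ?eqxx ?orbT//.
rewrite (@sym_fail_special t B) ?(@sym_fail_special t O) /special ?eqxx ?orbT//.
rewrite (eq_bigr (fun y => mut_prob R allones y * sym_fail t allones)) => [|y yBO]; last first.
  by rewrite ea_select_allones// /special negb_or.
rewrite -mulr_suml.
have := sum_mut_prob R (@allones n).
rewrite (bigD1 B)//= (bigD1 O) ?(eq_sym O) ?trap_neq_opt//=.
rewrite 2!mut_probE hamming_allones_trap// hamming_allones_opt//.
rewrite -/pjump => e.
have -> : \sum_(i | (i != B) && (i != O)) mut_prob R allones i = 1 - 2%:R * pjump.
  by move: e; lra.
by field.
Qed.

Lemma estep_dist x :
  estep (fun y => (dist r y)%:R) x <= (1 - pstep) * (dist r x)%:R.
Proof.
have selle y : (dist r (ea_select r x y) <= dist r x)%N.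
  by rewrite /dist fork_select; lia.
have [d0|d0] := posnP (dist r x).
  rewrite d0 mulr0 /estep big1// => y _.
  by have := selle y; rewrite d0 leqn0 => /eqP->; rewrite mulr0.
have nsx : ~~ special r x by apply: contraTN d0 => /(dist_special r0 rn) ->.
have pt y : (dist r (ea_select r x y) + \sum_(i | ~~ x i) (y == flip i x) <= dist r x)%N.
  have [/existsP[i /andP[xi /eqP yi]]|/existsPn h] := boolP [exists i, ~~ x i && (y == flip i x)].
    rewrite (bigD1 i)//= yi eqxx big1 => [|j /andP[_ ji]]; last first.
      by rewrite (inj_eq (@flip_inj _ x)) eq_sym (negbTE ji).
    have := fork_ge_ones r0 rn (flip i x); rewrite ones_flip//.
    by move: d0; rewrite /dist fork_select (fork_ones nsx); lia.
  rewrite big1 ?addn0// => i xi; have := h i; rewrite xi /=.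
  by move/negbTE->.
apply: (@le_trans _ _ (\sum_y mut_prob R x y * ((dist r x)%:R - \sum_(i | ~~ x i) (y == flip i x)%:R))).
  apply: ler_sum => y _; rewrite ler_wpM2l ?mut_prob_ge0// lerBrDr -natr_sum -natrD.
  by rewrite ler_nat.
under eq_bigr do rewrite mulrBr.
rewrite sumrB -mulr_suml sum_mut_prob mul1r mulrBl mul1r lerD2l lerN2.
under [leRHS]eq_bigr do rewrite mulr_sumr.
rewrite exchange_big /=.
rewrite (eq_bigr (fun=> pstep)) => [|i xi]; last first.
  rewrite (bigD1 (flip i x))//= eqxx mulr1 big1 ?addr0 => [|y /negbTE->]; last by rewrite mulr0.
  by rewrite mut_probE hamming_flip expr1.
rewrite sumr_const card_zeros -(fork_ones nsx) mulr_natr lexx//.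
Qed.

End Island.

Section Mixture.
Variables (R : realType) (p q : R).
Hypotheses (q0 : 0 < q) (qp : q < p) (p1 : 2%:R * p <= 1).

Definition mixw : R := p / (2%:R * p - q).

(* [mixture s] is the exact survival probability from the all-ones string: it leaves
   at rate [p] to the optimum and at rate [p] to the trap, from which it escapes at
   rate [q]. *)
Definition mixture (s : nat) : R :=
  mixw * (1 - q) ^+ s + (1 - mixw) * (1 - 2%:R * p) ^+ s.

Lemma mixtureS s : mixture s.+1 = (1 - 2%:R * p) * mixture s + p * (1 - q) ^+ s.
Proof.
have d0 : 0 < 2%:R * p - q by move: q0 qp p1; lra.
have e : mixw * (2%:R * p - q) = p by rewrite /mixw divfK// gt_eqF.
rewrite /mixture !exprS.
apply/eqP; rewrite -subr_eq0; apply/eqP.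
rewrite [LHS](_ : _ = (mixw * (2%:R * p - q) - p) * (1 - q) ^+ s); last by ring.
by rewrite e subrr mul0r.
Qed.

Lemma mixw_itv : 2%:R^-1 <= mixw < 1.
Proof.
have d0 : 0 < 2%:R * p - q by move: q0 qp p1; lra.
by rewrite /mixw ler_pdivlMr// ltr_pdivrMr//; move: q0 qp p1; lra.
Qed.

Lemma half_le_mixture s : (1 - q) ^+ s / 2%:R <= mixture s.
Proof.
have /andP[k0 k1] := mixw_itv.
have b0 : 0 <= (1 - q) ^+ s by rewrite exprn_ge0//; move: q0 qp p1; lra.
have a0 : 0 <= (1 - mixw) * (1 - 2%:R * p) ^+ s by rewrite mulr_ge0 ?exprn_ge0//; move: q0 qp p1; lra.
have : (1 - q) ^+ s * 2%:R^-1 <= (1 - q) ^+ s * mixw by rewrite ler_wpM2l.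
rewrite /mixture; move: q0 qp p1; nra.
Qed.

Lemma mixture_ge0 s : 0 <= mixture s.
Proof.
apply: le_trans (half_le_mixture s); rewrite divr_ge0// exprn_ge0//; move: q0 qp p1; lra.
Qed.

End Mixture.

Section Potential.
Variables (R : realType) (n r : nat).
Hypothesis n5 : (5 <= n)%N.
Local Notation p := (pjump R n r).
Local Notation q := (ptrap R n r).
Local Notation a := (pstep R n).

Let nR0 : 0 < n%:R :> R. Proof. by rewrite ltr0n; lia. Qed.

Lemma subn1_mulV : n.-1%:R * n%:R^-1 = 1 - n%:R^-1 :> R.
Proof.
have -> : n%:R = n.-1%:R + 1 :> R by rewrite natr1 prednK//; lia.
by field; rewrite natr1 pnatr_eq0.
Qed.

Lemma subV_gt0 : 0 < 1 - n%:R^-1 :> R.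
Proof. by rewrite -subn1_mulV mulr_gt0 ?invr_gt0// ltr0n; lia. Qed.

Lemma predn_exp_ge4 (m : nat) : (0 < m)%N -> 4%:R <= n.-1%:R ^+ m :> R.
Proof.
move=> m0; rewrite -natrX ler_nat -[4%N]/(4 ^ 1)%N (leq_trans (leq_pexp2l _ m0))//.
by rewrite leq_exp2r//; lia.
Qed.

Lemma pstep_ge : expR (-1) / n%:R <= a.
Proof. by rewrite mulrC /pstep ler_pM2l ?invr_gt0// expR_N1_le_subV//; lia. Qed.

Lemma pstep_le1 : a <= 1.
Proof.
have /andP[i0 i1] := invn_itv R n.
apply: mulr_ile1 => //; first by rewrite exprn_ge0 ?(ltW subV_gt0).
by apply: exprn_ile1; [exact: ltW subV_gt0 | lra].
Qed.

Hypotheses (r2 : (2 <= r)%N) (rn : (2 * r <= n)%N).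
Let r0 : (0 < r)%N. Proof. exact: ltnW. Qed.

Lemma ptrap_mul : q * n.-1%:R ^+ r = p.
Proof.
rewrite /ptrap /pjump.
have -> : (1 - n%:R^-1) ^+ (n - r) = (1 - n%:R^-1) ^+ (n - 2 * r) * (n.-1%:R ^+ r * n%:R^-1 ^+ r) :> R.
  by rewrite -exprMn subn1_mulV -exprD; congr (_ ^+ _); lia.
by rewrite mul2n -addnn exprD; ring.
Qed.

Lemma pjump_mul : p * n.-1%:R ^+ r.-1 = a.
Proof.
rewrite /pjump /pstep.
have -> : (1 - n%:R^-1) ^+ (n - 1) = (1 - n%:R^-1) ^+ (n - r) * (n.-1%:R ^+ r.-1 * n%:R^-1 ^+ r.-1) :> R.
  by rewrite -exprMn subn1_mulV -exprD; congr (_ ^+ _); lia.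
have -> : n%:R^-1 ^+ r = n%:R^-1 * n%:R^-1 ^+ r.-1 :> R by rewrite -exprS prednK.
by ring.
Qed.

Lemma ptrap_ge : expR (-1) / n%:R ^+ (2 * r) <= q.
Proof.
rewrite mulrC /ptrap -exprVn ler_pM2l ?exprn_gt0 ?invr_gt0//.
by rewrite expR_N1_le_subV//; lia.
Qed.

Lemma pjump_ge : expR (-1) / n%:R ^+ r <= p.
Proof.
rewrite mulrC /pjump -exprVn ler_pM2l ?exprn_gt0 ?invr_gt0//.
by rewrite expR_N1_le_subV//; lia.
Qed.

Lemma pjump_gt0 : 0 < p.
Proof. by apply: lt_le_trans pjump_ge; rewrite divr_gt0 ?expR_gt0 ?exprn_gt0. Qed.

Lemma ptrap_gt0 : 0 < q.
Proof. by apply: lt_le_trans ptrap_ge; rewrite divr_gt0 ?expR_gt0 ?exprn_gt0. Qed.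

Lemma pjump_le_pstep : 4%:R * p <= a.
Proof.
rewrite -pjump_mul mulrC ler_pM2l ?pjump_gt0//.
by apply: predn_exp_ge4; lia.
Qed.

Lemma ptrap_lt_pjump : q < p.
Proof.
rewrite -ptrap_mul ltr_pMr ?ptrap_gt0//; have := predn_exp_ge4 r0; lra.
Qed.

Let q0 := ptrap_gt0.
Let p0 := pjump_gt0.
Let qp := ptrap_lt_pjump.
Let p1 : 2%:R * p <= 1.
Proof. have := pjump_le_pstep; have := pstep_le1; lra. Qed.

Local Notation h := (mixture p q).

Lemma mixture_ratio s : (1 - 2%:R * p) * h s <= h s.+1.
Proof.
rewrite mixtureS ?q0// lerDl mulr_ge0 ?(ltW p0)// exprn_ge0//; move: q0 qp p1; lra.
Qed.

Lemma estep_sym_fail_le s t (c : R) (x : bits n) : 0 <= c ->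
  (forall y : bits n, sym_fail R r t y <= h s * (1 + c * (dist r y)%:R)) ->
  ~~ special r x ->
  sym_fail R r t.+1 x <= h s * (1 + c * ((1 - a) * (dist r x)%:R)).
Proof.
move=> c0 IH sx; rewrite sym_failS//.
pose g (y : bits n) : R := h s * (1 + c * (dist r y)%:R).
apply: (@le_trans _ _ (estep r g x)); first by apply: estep_le => y; exact: IH.
have -> : estep r g x =
    h s + (h s * c) * estep r (fun y => (dist r y)%:R) x.
  by rewrite -estep_affine /estep; apply: eq_bigr => y _; rewrite /g; ring.
rewrite mulrDr mulr1 lerD2l -mulrA ler_wpM2l ?mixture_ge0// ler_wpM2l//.
exact: estep_dist.
Qed.

Lemma sym_fail_le_mixture s (x : bits n) :
  sym_fail R r s x <= h s * (1 + (dist r x)%:R).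
Proof.
elim: s x => [|s IH] x.
  rewrite {1}/mixture !expr0 !mulr1 addrC subrK mul1r.
  apply: (@le_trans _ _ 1); last by rewrite lerDl.
  have /andP[_] := ea_fail_itv R r 0 x.
  have /andP[_] := ea_fail_itv R r 0 (rev_bits x).
  by rewrite /sym_fail; lra.
have [sx|sx] := boolP (special r x).
  rewrite sym_fail_special// dist_special// addr0 mulr1.
  exact: half_le_mixture.
have [d0|d0] := posnP (dist r x).
  rewrite d0 addr0 mulr1 (dist_eq0 r0 rn sx d0) sym_fail_allones// mixtureS//.
  rewrite lerD2r ler_wpM2l//; first by move: p1; lra.
  by have := IH allones; rewrite -(dist_eq0 r0 rn sx d0) d0 addr0 mulr1.
have := @estep_sym_fail_le s s 1 x ler01.
have IH' (y : bits n) : sym_fail R r s y <= h s * (1 + 1 * (dist r y)%:R) by rewrite mul1r.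
move=> /(_ IH' sx) /le_trans; apply.
apply: (@le_trans _ _ ((1 - 2%:R * p) * h s * (1 + (dist r x)%:R))); last first.
  by rewrite ler_wpM2r ?mixture_ratio// addr_ge0.
rewrite mul1r [(_ - 2%:R * p) * _]mulrC -mulrA ler_wpM2l ?mixture_ge0//.
have d1 : 1 <= (dist r x)%:R :> R by rewrite ler1n.
have pa : 0 <= (a - 4%:R * p) * (dist r x)%:R by rewrite mulr_ge0// subr_ge0 pjump_le_pstep.
have pd : 0 <= p * ((dist r x)%:R - 1) by rewrite mulr_ge0 ?(ltW p0)// subr_ge0.
by move: pa pd; nra.
Qed.

Lemma sym_fail_le t s (x : bits n) :
  sym_fail R r (t + s) x <= h s * (1 + (1 - a) ^+ t * (dist r x)%:R).
Proof.
have a1 := pstep_le1.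
elim: t x => [|t IH] x; first by rewrite expr0 mul1r sym_fail_le_mixture.
have [sx|sx] := boolP (special r x).
  rewrite sym_fail_special// dist_special// mulr0 addr0 mulr1.
  apply: le_trans (half_le_mixture q0 qp p1 s).
  rewrite ler_pM2r ?invr_gt0// exprD ler_piMl ?exprn_ge0 ?exprn_ile1//; move: q0 qp p1; lra.
rewrite exprSr -mulrA addSn; apply: estep_sym_fail_le => //.
by rewrite exprn_ge0//; move: q0 qp p1; lra.
Qed.

Lemma fail_prob_le t s : fail_prob R n r (t + s) <= h s * (1 + (1 - a) ^+ t * n%:R).
Proof.
rewrite fail_prob_sym; apply: average_le => x; apply: le_trans (sym_fail_le _ _ _) _.
rewrite ler_wpM2l ?mixture_ge0// lerD2l ler_wpM2l ?ler_nat ?dist_le//.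
by rewrite exprn_ge0//; have := pstep_le1; lra.
Qed.

End Potential.

Lemma tailT_itv (R : realType) lam n r t : 0 <= tailT R lam n r t <= 1.
Proof.
have /andP[f0 f1] := fail_prob_itv R n r t.
by rewrite tailT_fail_prob exprn_ge0 ?exprn_ile1.
Qed.

Lemma expT_le (R : realType) lam n r (c : R) :
  (forall M, \sum_(t < M) tailT R lam n r t <= c) -> (expT R lam n r <= c%:E)%E.
Proof.
move=> h; apply: lime_le.
  apply: is_cvg_nneseries => t _ _; rewrite lee_fin.
  by case/andP: (tailT_itv R lam n r t).
by apply: nearW => M; rewrite sumEFin lee_fin big_mkord.
Qed.

Section Bounds.
Variables (R : realType) (n r lam : nat).
Hypothesis n5 : (5 <= n)%N.
Local Notation p := (pjump R n r).
Local Notation q := (ptrap R n r).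
Local Notation a := (pstep R n).
Local Notation k := (mixw p q).
Local Notation e := (expR (1 : R)).

Let nR0 : 0 < n%:R :> R. Proof. by rewrite ltr0n; lia. Qed.
Let e0 : 0 < e. Proof. exact: expR_gt0. Qed.
Let L : R := ln n%:R.

Lemma invr_expRN1_div (x y : R) : 0 < x -> expR (-1) / x <= y -> y^-1 <= e * x.
Proof.
move=> x0 xy; have e' : 0 < expR (-1 : R) by exact: expR_gt0.
rewrite -[leRHS]invrK lef_pV2 ?posrE ?invr_gt0 ?mulr_gt0//; last first.
  by apply: lt_le_trans xy; rewrite divr_gt0.
by rewrite invfM -expRN.
Qed.

Lemma n_ln_ge1 : 1 <= n%:R * L.
Proof.
have n5R : 5%:R <= n%:R :> R by rewrite ler_nat.
have i0 : 0 < (n%:R^-1 : R) by rewrite invr_gt0.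
have := @le_ln1Dx R (n%:R^-1 - 1).
rewrite [1 + _]addrC subrK lnV ?posrE// -/L => h.
have h' : 1 - n%:R^-1 <= L by have := h ltac:(lra); lra.
have : n%:R * (1 - n%:R^-1) <= n%:R * L by rewrite ler_pM2l.
rewrite mulrBr mulr1 divff ?gt_eqF//; lra.
Qed.

Definition warmup : nat := (Num.truncn (e * r.+1%:R * (n%:R * L))).+1.

Lemma warmup_le : warmup%:R <= e * r.+1%:R * (n%:R * L) + 1.
Proof.
rewrite /warmup -natr1 lerD2r truncn_le//.
apply: mulr_ge0; last by have := n_ln_ge1; lra.
by rewrite mulr_ge0 ?expR_ge0.
Qed.

Lemma warmup_decay : (1 - a) ^+ warmup * n%:R <= (n%:R ^+ r)^-1.
Proof.
rewrite -ler_pdivlMr// -invfM -exprSr.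
have -> : (n%:R ^+ r.+1)^-1 = expR (- (r.+1%:R * L)) :> R.
  by rewrite expRN expRM_natl lnK ?posrE.
apply: (@le_trans _ _ (expR (- a) ^+ warmup)).
  rewrite lerXn2r ?nnegrE ?expR_ge0 ?expR_ge1Dx// subr_ge0.
  exact: pstep_le1.
rewrite -expRM_natl ler_expR mulrN lerN2.
apply: (@le_trans _ _ ((e * r.+1%:R * (n%:R * L)) * (expR (-1) / n%:R))).
  rewrite expRN le_eqVlt; apply/orP; left; apply/eqP.
  by field; rewrite !gt_eqF.
rewrite ler_pM ?pstep_ge//.
- apply: mulr_ge0; last by have := n_ln_ge1; lra.
  by rewrite mulr_ge0 ?expR_ge0.
- by rewrite ltW// truncnS_gt.
Qed.

Hypotheses (r2 : (2 <= r)%N) (rn : (2 * r <= n)%N).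
Let w : R := n.-1%:R ^+ r.
Let w4 : 4%:R <= w. Proof. by rewrite predn_exp_ge4//; lia. Qed.

Lemma mixwE : k = w / (2%:R * w - 1).
Proof.
have qne : q != 0 by rewrite gt_eqF ?ptrap_gt0.
have d : 2%:R * w - 1 != 0 by rewrite gt_eqF//; move: w4; lra.
rewrite /mixw -(ptrap_mul R n5 r2 rn) -/w; field.
rewrite d/= [X in X != 0](_ : _ = q * (2%:R * w - 1)) ?(mulf_neq0 qne d)//; ring.
Qed.

Lemma mixw_le : k <= 3%:R / 4%:R.
Proof.
have d0 : 0 < 2%:R * w - 1 by move: w4; lra.
by rewrite mixwE ler_pdivrMr//; move: w4; lra.
Qed.

Hypotheses (lam0 : (1 <= lam)%N) (lam_le : (lam <= n ^ r)%N).
Let lR0 : 0 < lam%:R :> R. Proof. by rewrite ltr0n. Qed.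

Lemma mixw_pow_le : k ^+ lam <= expR (2%:R ^+ r) / 2%:R ^+ lam.
Proof.
have w0 : 0 < w by move: w4; lra.
have d0 : 0 < 2%:R * w - 1 by move: w4; lra.
have k0 : 0 <= k by rewrite mixwE divr_ge0// ltW.
rewrite ler_pdivlMr ?exprn_gt0// -exprMn.
have -> : k * 2%:R = 1 + (2%:R * w - 1)^-1.
  by rewrite mixwE; field; rewrite gt_eqF.
apply: le_trans (exp1D_le_expR _ _) _; first by rewrite invr_ge0 ltW.
rewrite ler_expR ler_pdivrMr//.
apply: (@le_trans _ _ (n%:R ^+ r)); first by rewrite -natrX ler_nat.
apply: (@le_trans _ _ (2%:R ^+ r * w)); last first.
  by rewrite ler_pM2l ?exprn_gt0//; move: w4; lra.
rewrite -exprMn lerXn2r ?nnegrE ?mulr_ge0 ?ler0n// -natrM ler_nat; lia.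
Qed.

Lemma sum_mixture_le (M : nat) : \sum_(s < M) mixture p q s ^+ lam <=
  1 + e * expR (2%:R ^+ r) * (n%:R ^+ (2 * r) / (lam%:R * 2%:R ^+ lam))
    + 4%:R * e * (n%:R ^+ r / lam%:R).
Proof.
have q0 : 0 < q := ptrap_gt0 R n5 r2 rn.
have p0 : 0 < p := pjump_gt0 R n5 r2 rn.
have qp : q < p := ptrap_lt_pjump R n5 r2 rn.
have p1 : 2%:R * p <= 1.
  have := pjump_le_pstep R n5 r2 rn; have := pstep_le1 R n5; lra.
have k34 := mixw_le.
have k0 : 0 <= k by rewrite mixwE divr_ge0//; move: w4; lra.
apply: le_trans (sum_mixture_pow_le _ _ _ _ _ _) _ => //; try lra.
have qi := invr_expRN1_div (exprn_gt0 (2 * r) nR0) (ptrap_ge R n5 r2 rn).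
have pi := invr_expRN1_div (exprn_gt0 r nR0) (pjump_ge R n5 r2 rn).
rewrite lerD// ?lerD2l.
  rewrite invfM.
  have -> : e * expR (2%:R ^+ r) * (n%:R ^+ (2 * r) / (lam%:R * 2%:R ^+ lam)) =
    expR (2%:R ^+ r) / 2%:R ^+ lam * (lam%:R^-1 * (e * n%:R ^+ (2 * r))).
    by field; rewrite gt_eqF ?exprn_gt0//= gt_eqF.
  apply: ler_pM; first exact: exprn_ge0.
  - by rewrite mulr_ge0 ?invr_ge0 ?ltW.
  - exact: mixw_pow_le.
  - by rewrite ler_wpM2l// invr_ge0 ltW.
have -> : 4%:R * e * (n%:R ^+ r / lam%:R) = (4%:R / lam%:R) * (e * n%:R ^+ r) by ring.
apply: ler_pM => //; first by rewrite invr_ge0 mulr_ge0//; lra.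
  by rewrite invr_ge0 ltW.
rewrite -[leRHS]invrK invf_div lef_pV2 ?posrE.
- have : 0 <= lam%:R * (3%:R / 4%:R - k) by rewrite mulr_ge0// subr_ge0.
  by rewrite -natr1; move: k34; nra.
- by rewrite mulr_gt0 ?ltr0n//; lra.
- by rewrite mulr_gt0 ?invr_gt0.
Qed.

Lemma tailT_warmup_le s : tailT R lam n r (warmup + s) <= e * mixture p q s ^+ lam.
Proof.
have q0 : 0 < q := ptrap_gt0 R n5 r2 rn.
have qp : q < p := ptrap_lt_pjump R n5 r2 rn.
have p1 : 2%:R * p <= 1.
  have := pjump_le_pstep R n5 r2 rn; have := pstep_le1 R n5; lra.
have /andP[f0 _] := fail_prob_itv R n r (warmup + s).
have h0 := mixture_ge0 q0 qp p1 s.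
have nr0 : 0 < n%:R ^+ r :> R by rewrite exprn_gt0.
rewrite tailT_fail_prob.
apply: (@le_trans _ _ ((mixture p q s * (1 + (n%:R ^+ r)^-1)) ^+ lam)).
  have b0 : 0 <= mixture p q s * (1 + (n%:R ^+ r)^-1).
    by rewrite mulr_ge0// addr_ge0// invr_ge0 ltW.
  rewrite lerXn2r ?nnegrE//; apply: le_trans (fail_prob_le R n5 r2 rn _ _) _.
  by rewrite ler_wpM2l// lerD2l warmup_decay.
rewrite exprMn mulrC ler_wpM2r ?exprn_ge0//.
apply: le_trans (exp1D_le_expR _ _) _; first by rewrite invr_ge0 ltW.
by rewrite ler_expR ler_pdivrMr// mul1r -natrX ler_nat.
Qed.

Lemma sum_tailT_le (M : nat) : \sum_(t < M) tailT R lam n r t <=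
  warmup%:R + e * \sum_(s < M) mixture p q s ^+ lam.
Proof.
have t01 := tailT_itv R lam n r.
apply: (@le_trans _ _ (\sum_(t < warmup + M) tailT R lam n r t)).
  rewrite (big_ord_widen _ (tailT R lam n r) (leq_addl warmup M)).
  rewrite [leRHS](bigID (fun t : 'I__ => (t < M)%N))/= lerDl sumr_ge0// => t _.
  by case/andP: (t01 t).
rewrite big_split_ord/= lerD//.
  apply: (@le_trans _ _ (\sum_(t < warmup) 1)); last by rewrite sumr_const card_ord.
  by apply: ler_sum => t _; case/andP: (t01 t).
by rewrite mulr_sumr ler_sum// => s _; exact: tailT_warmup_le.
Qed.

End Bounds.

Theorem theorem4 (R : realType) (r : nat) : (2 <= r)%N ->
  exists (C : R) (N : nat), 0 < C /\
    forall n lam : nat, (N <= n)%N -> (2 * r <= n)%N ->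
      (1 <= lam)%N -> (lam <= n ^ r)%N ->
      (expT R lam n r <=
        (C * (n%:R * ln (n%:R : R)
              + (n%:R ^+ (2 * r)) / (lam%:R * 2%:R ^+ lam)
              + (n%:R ^+ r) / lam%:R))%:E)%E.
Proof.
move=> r2; pose e : R := expR 1; pose E2 : R := expR (2%:R ^+ r).
have e0 : 0 < e by exact: expR_gt0.
have E20 : 0 < E2 by exact: expR_gt0.
have r0 : 0 <= r.+1%:R :> R by [].
pose c1 := e * r.+1%:R + 1 + e; pose c2 := e * (e * E2); pose c3 := e * (4%:R * e).
have c10 : 0 < c1 by rewrite /c1; have := mulr_ge0 (ltW e0) r0; lra.
have c20 : 0 < c2 by apply: mulr_gt0 => //; exact: mulr_gt0.
have c30 : 0 < c3 by apply: mulr_gt0 => //; exact: mulr_gt0.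
exists (c1 + c2 + c3), 5%N; split; first by apply: addr_gt0 => //; exact: addr_gt0.
move=> n lam n5 rn l0 ln; apply: expT_le => M.
apply: le_trans (sum_tailT_le R n5 r2 rn ln M) _.
set X : R := n%:R ^+ (2 * r) / _; set Y : R := n%:R ^+ r / _; set Z : R := n%:R * _.
have X0 : 0 <= X by rewrite divr_ge0 ?exprn_ge0// mulr_ge0 ?exprn_ge0.
have Y0 : 0 <= Y by rewrite divr_ge0 ?exprn_ge0.
have Z1 : 1 <= Z by exact: n_ln_ge1.
apply: (@le_trans _ _ (c1 * Z + c2 * X + c3 * Y)); last first.
  have Z0 := le_trans ler01 Z1.
  by rewrite !mulrDr; do 2?apply: lerD; apply: ler_wpM2r => //; lra.
have hw : (warmup R n r)%:R <= e * r.+1%:R * Z + 1 by exact: warmup_le.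
have hs := sum_mixture_le R n5 r2 rn l0 ln M.
have := ler_wpM2l (ltW e0) hs; rewrite -/e -/E2 -/X -/Y /c1 /c2 /c3.
move: hw; nra.
Qed.
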